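(* For every nonnegative integer $n$ and complex parameters $\alpha,a,b,\beta,\gamma,u,v$ (with all denominators nonzero), \begin{align*} \sum_{k=0}^{n} \frac{(q^{-n}, \alpha q^n, \alpha \beta ab/q, \alpha \gamma ab/q ; q)_k\, q^k}{(q, \alpha a, \alpha b, \beta \gamma uv; q)_k} A_k =\frac{(q/a, q/b; q)_n}{(\alpha a, \alpha b; q)_n}\biggl(\frac{\alpha ab}{q}\biggr)^n\sum_{k=0}^{n} \frac{(q^{-n}, \alpha q^n, \beta, \gamma; q)_k\, q^k}{(q, q/a, q/b, \beta \gamma uv; q)_k}B_k, \end{align*} where \[ A_k= {}_3\phi_2 \biggl({{q^{-k}, \alpha ab/(qu), \alpha ab/(qv)}\atop{\alpha \beta ab/q, \alpha \gamma ab/q }}; q, \beta \gamma uv q^k \biggr),\qquad B_k={}_3\phi_2 \biggl({{q^{-k}, 1/u, 1/v}\atop{\beta, \gamma}}; q, \beta \gamma uv q^k\biggr). \]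
   Context: Throughout, $q$ is a complex number with $0<|q|<1$. For $x\in\mathbb{C}$ and an integer $n\ge 0$, $(x;q)_n=\prod_{k=0}^{n-1}(1-xq^k)$, and $(x_1,\dots,x_m;q)_n=(x_1;q)_n\cdots(x_m;q)_n$. The basic hypergeometric series is ${}_r\phi_s\Bigl({{a_1,\dots,a_r}\atop{b_1,\dots,b_s}};q,z\Bigr)=\sum_{n=0}^\infty \frac{(a_1,\dots,a_r;q)_n}{(q,b_1,\dots,b_s;q)_n}\bigl((-1)^nq^{n(n-1)/2}\bigr)^{1+s-r}z^n$; with an upper parameter $q^{-k}$ it is a finite sum. *)

(* Defs.v *)
From HB Require Import structures.
From mathcomp Require Import all_boot all_order all_algebra.
From mathcomp Require Import complex.
Set Implicit Arguments. Unset Strict Implicit. Unset Printing Implicit Defensive.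
Import Order.TTheory GRing.Theory Num.Theory.
Local Open Scope ring_scope.

Definition qpoch (F : ringType) (q x : F) (n : nat) : F :=
  \prod_(k < n) (1 - x * q ^+ k).

(* Terminating 3phi2 with first upper parameter q^{-k}:
   3phi2(q^{-k}, a2, a3; b1, b2; q, z)
   = sum_{j>=0} (q^{-k},a2,a3;q)_j / (q,b1,b2;q)_j z^j.
   For r = s+1 the factor ((-1)^j q^{j(j-1)/2})^{1+s-r} equals 1, and all
   terms with j > k vanish since (q^{-k};q)_j = 0, so the sum stops at j = k. *)
Definition tphi32 (F : fieldType) (q : F) (k : nat) (a2 a3 b1 b2 z : F) : F :=
  \sum_(j < k.+1)
    (qpoch q (q ^- k) j * qpoch q a2 j * qpoch q a3 j)
    / (qpoch q q j * qpoch q b1 j * qpoch q b2 j) * z ^+ j.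

(* Main.v *)
Require Import Defs.
From HB Require Import structures.
From mathcomp Require Import all_boot all_order all_algebra.
From mathcomp Require Import complex.
From mathcomp Require Import ring zify.
Import Order.TTheory GRing.Theory Num.Theory.
Local Open Scope ring_scope.
Local Open Scope complex_scope.

(* Put D_k = (beta, gamma; q)_k / (beta gamma u v; q)_k B_k and
   E_j = sum_k (q^-j; q)_k q^k / (q; q)_k D_k.  Inverting, D_k is the q-binomial
   transform of the E_j, and up to the factor 1 / (beta gamma u v; q)_j the E_j
   are polynomials in p = beta u, s = gamma v, x = 1/u, y = 1/v, homogeneous of
   degree j in (x, y) (hcoef below).  The passage from the right-hand side to the
   left-hand side replaces (x, y) by (t x, t y), t = alpha a b / q, and keeps p and
   s, hence just multiplies E_j by t^j.  Exchanging the sums reduces the identity to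
   its coefficient of E_j, which is the two-term relation between
   3phi2(q^-N, A q^N, 0; d, e; q, q) and the same series with lower parameters
   A q / d, A q / e. *)

(** * Gaussian binomials and convolutions of homogeneous q-shifted factorials *)

Section QBinomial.
Set Implicit Arguments.
Unset Strict Implicit.
Variables (F : fieldType) (q : F).

(* The homogeneous form x^n (y/x; q)_n, which stays meaningful at x = 0; note that
   hpoch 0 1 n = (-1)^n q^(n(n-1)/2). *)
Definition hpoch (x y : F) (n : nat) : F := \prod_(i < n) (x - y * q ^+ i).

(** The Gaussian binomial, given by a q-Pascal rule so that no division occurs and every [q] is
    allowed. Where [n' - k'] truncates, its cofactor [qbin n' k'] vanishes. *)
Fixpoint qbin (n k : nat) : F :=
  match n, k with
  | _, 0 => 1
  | 0, _.+1 => 0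
  | n'.+1, k'.+1 => qbin n' k'.+1 + q ^+ (n' - k') * qbin n' k'
  end.

Lemma qpochE x n : qpoch q x n = hpoch 1 x n.
Proof. by []. Qed.

Lemma hpoch0 x y : hpoch x y 0 = 1.
Proof. exact: big_ord0. Qed.

Lemma hpochS x y n : hpoch x y n.+1 = hpoch x y n * (x - y * q ^+ n).
Proof. exact: big_ord_recr. Qed.

Lemma hpochD x y m n : hpoch x y (m + n) = hpoch x y m * hpoch x (y * q ^+ m) n.
Proof.
elim: n => [|n IHn]; first by rewrite addn0 hpoch0 mulr1.
by rewrite addnS !hpochS IHn -mulrA -[y * _ * _]mulrA -exprD.
Qed.

Lemma hpochSl x y n : hpoch x y n.+1 = (x - y) * hpoch x (y * q) n.
Proof. by rewrite -add1n hpochD hpochS hpoch0 mul1r expr0 mulr1 expr1. Qed.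

Lemma hpochZ t x y n : hpoch (t * x) (t * y) n = t ^+ n * hpoch x y n.
Proof.
elim: n => [|n IHn]; first by rewrite !hpoch0 mulr1.
by rewrite !hpochS IHn exprS; ring.
Qed.

Lemma hpoch_homog t y n : hpoch t (t * y) n = t ^+ n * hpoch 1 y n.
Proof. by rewrite -hpochZ mulr1. Qed.

Lemma hpoch0E y n : hpoch 0 y n = y ^+ n * hpoch 0 1 n.
Proof. by rewrite -hpochZ mulr0 mulr1. Qed.

Lemma hpochx0 x n : hpoch x 0 n = x ^+ n.
Proof.
elim: n => [|n IHn]; first by rewrite hpoch0.
by rewrite hpochS IHn mul0r subr0 exprSr.
Qed.

Lemma hpoch11 n : hpoch 1 1 n = (n == 0)%:R.
Proof. by case: n => [|n]; rewrite ?hpoch0 // hpochSl subrr mul0r. Qed.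

Lemma qbin0 n : qbin n 0 = 1.
Proof. by case: n. Qed.

Lemma qbin_small n k : (n < k)%N -> qbin n k = 0.
Proof.
elim: n k => [|n IHn] [|k] //= lt_nk.
by rewrite !IHn ?mulr0 ?addr0 // ltnW.
Qed.

Lemma qbin_fact n k : (k <= n)%N ->
  qbin n k * (qpoch q q k * qpoch q q (n - k)) = qpoch q q n.
Proof.
rewrite !qpochE.
elim: n k => [|n IHn] [|k] //; rewrite ?subn0 ?qbin0 ?hpoch0 ?mul1r // => lekn.
rewrite [qbin _ _]/= subSS.
have := IHn k lekn; move: lekn; rewrite ltnS leq_eqVlt => /predU1P[<-|ltkn].
  rewrite subnn hpoch0 hpochS !mulr1 (@qbin_small k k.+1) // add0r expr0 mul1r.
  by move=> E; rewrite -{2}E; ring.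
have := IHn k.+1 ltkn.
have -> : (n - k)%N = (n - k.+1).+1 by lia.
rewrite !hpochS => E1 E2.
have Eq : q ^+ n = q ^+ k * q ^+ (n - k.+1) * q.
  by rewrite -exprD -exprSr; congr (_ ^+ _); lia.
(* Both induction hypotheses are isolated here; their weights combine by 1 - q^(n+1) = (1 - q^(n-k))
   + q^(n-k) (1 - q^(k+1)). *)
transitivity ((qbin n k.+1 * (hpoch 1 q k * (1 - q * q ^+ k) * hpoch 1 q (n - k.+1)))
   * (1 - q * q ^+ (n - k.+1)) + q ^+ (n - k.+1).+1 *
   (qbin n k * (hpoch 1 q k * (hpoch 1 q (n - k.+1) * (1 - q * q ^+ (n - k.+1)))))
   * (1 - q * q ^+ k)); first by ring.
by rewrite E1 E2 Eq exprS; ring.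
Qed.

Lemma sum_qbinS n (f : nat -> F) :
  \sum_(s < n.+2) qbin n.+1 s * f s =
  \sum_(s < n.+1) qbin n s * (f s + q ^+ (n - s) * f s.+1).
Proof.
have -> : \sum_(s < n.+1) qbin n s * (f s + q ^+ (n - s) * f s.+1) =
  \sum_(s < n.+2) qbin n s * f s
    + \sum_(s < n.+1) qbin n s * (q ^+ (n - s) * f s.+1).
  rewrite [X in _ = X + _]big_ord_recr /= (@qbin_small n n.+1) // mul0r addr0 -big_split /=.
  by apply: eq_bigr => s _; rewrite mulrDr.
rewrite big_ord_recl [in RHS]big_ord_recl !qbin0 -addrA -big_split /=.
by congr (_ + _); apply: eq_bigr => s _; rewrite /bump /= add1n; ring.
Qed.

(** A q-analogue of expanding ((x - y) + (y - z))^n. The inductive step is x - z q^n = (x - y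
    q^(n-s)) + q^(n-s) (y - z q^s). *)
Lemma hpoch_conv x y z n :
  hpoch x z n = \sum_(s < n.+1) qbin n s * (hpoch x y (n - s) * hpoch y z s).
Proof.
elim: n => [|n IHn]; first by rewrite big_ord1 !hpoch0 !mulr1.
rewrite (sum_qbinS n (fun s => hpoch x y (n.+1 - s) * hpoch y z s)).
rewrite hpochS IHn mulr_suml; apply: eq_bigr => s _.
have les : (s <= n)%N by rewrite -ltnS.
rewrite subSS subSn // !hpochS.
have -> : q ^+ n = q ^+ (n - s) * q ^+ s by rewrite -exprD subnK.
by ring.
Qed.

Lemma sum_triangle n (f : nat -> nat -> F) :
  \sum_(k < n.+1) \sum_(j < k.+1) f k j =
  \sum_(j < n.+1) \sum_(s < (n - j).+1) f (j + s)%N j.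
Proof.
elim: n => [|n IHn]; first by rewrite !big_ord1.
rewrite big_ord_recr /= IHn [in RHS]big_ord_recr /= subnn big_ord1 addn0.
rewrite [X in _ + X]big_ord_recr /= addrA; congr (_ + _).
rewrite -big_split /=; apply: eq_bigr => j _.
have lej : (j <= n)%N by rewrite -ltnS.
by rewrite subSn // [in RHS]big_ord_recr /= -subSn // subnKC // ltnW.
Qed.

Hypothesis q_nroot : forall k, q ^+ k.+1 != 1.

Lemma qfact_neq0 n : qpoch q q n != 0.
Proof. by apply/prodf_neq0 => i _; rewrite subr_eq0 eq_sym -exprS. Qed.

Lemma qbinE n k : (k <= n)%N ->
  qbin n k = qpoch q q n / (qpoch q q k * qpoch q q (n - k)).
Proof.
by move=> lekn; rewrite -(qbin_fact lekn) mulfK // mulf_neq0 // qfact_neq0.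
Qed.

Lemma qbinC n k : (k <= n)%N -> qbin n (n - k) = qbin n k.
Proof. by move=> lekn; rewrite !qbinE ?leq_subr // subKn // [X in _ / X]mulrC. Qed.

Lemma qbin_trans n j s : (j + s <= n)%N ->
  qbin n (j + s) * qbin (j + s) j = qbin n j * qbin (n - j) s.
Proof.
move=> le_n; have lej : (j <= n)%N by apply: leq_trans le_n; rewrite leq_addr.
rewrite !qbinE ?leq_addr ?leq_subRL // addKn subnDA.
by field; rewrite !qfact_neq0.
Qed.

(** Put k = j + s and use [qbin_trans]. All later exchanges of summation rest on this regrouping. *)
Lemma sum_qbin_triangle n (f : nat -> nat -> F) :
  \sum_(k < n.+1) qbin n k * (\sum_(j < k.+1) qbin k j * f j (k - j)%N) =
  \sum_(j < n.+1) qbin n j * (\sum_(s < (n - j).+1) qbin (n - j) s * f j s).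
Proof.
transitivity (\sum_(k < n.+1) \sum_(j < k.+1)
                qbin n k * (qbin k j * f j (k - j)%N)).
  by apply: eq_bigr => k _; rewrite mulr_sumr.
rewrite (sum_triangle n (fun k j => qbin n k * (qbin k j * f j (k - j)%N))).
apply: eq_bigr => -[j ltj] _; rewrite mulr_sumr; apply: eq_bigr => -[s /= lts] _.
by rewrite mulrA qbin_trans ?addKn ?mulrA //; lia.
Qed.

Lemma sum_qbin_exchange n (f : nat -> nat -> F) :
  \sum_(j < n.+1) qbin n j * (\sum_(s < (n - j).+1) qbin (n - j) s * f j s) =
  \sum_(s < n.+1) qbin n s * (\sum_(j < (n - s).+1) qbin (n - s) j * f j s).
Proof.
rewrite -sum_qbin_triangle -(sum_qbin_triangle n (fun s j => f j s)).
apply: eq_bigr => k _; congr (_ * _).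
rewrite (reindex_inj rev_ord_inj); apply: eq_bigr => -[j ltj] _ /=.
by rewrite subSS qbinC // subKn.
Qed.

(** Expand the last factor on the left through the point [y], so that [hpoch y z i] extends to
    length r = i + s. At fixed r the sum over i is [hpoch_conv] through 0 and yields
    [hpoch 1 t r]. *)
Lemma hpoch_conv_shift t x y z m :
  \sum_(i < m.+1) qbin m i
      * (hpoch 0 t i * hpoch y z i * hpoch x (z * q ^+ i) (m - i)) =
  \sum_(r < m.+1) qbin m r * (hpoch x y (m - r) * hpoch y z r * hpoch 1 t r).
Proof.
pose f i s := hpoch 0 t i * hpoch y z (i + s) * hpoch x y (m - (i + s)).
transitivity (\sum_(j < m.+1) qbin m j * (\sum_(s < (m - j).+1) qbin (m - j) s * f j s)).
  apply: eq_bigr => -[i lti] _ /=; congr (_ * _).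
  rewrite (hpoch_conv x y) mulr_sumr; apply: eq_bigr => s _.
  by rewrite /f hpochD subnDA; ring.
rewrite -sum_qbin_triangle; apply: eq_bigr => -[r ltr] _ /=; congr (_ * _).
rewrite (hpoch_conv 1 0 t) mulr_sumr; apply: eq_bigr => -[i lti] _ /=.
by rewrite /f subnKC // hpochx0 expr1n; ring.
Qed.

(** The q-Chu-Vandermonde sum cleared of denominators: the case t = 1 of [hpoch_conv_shift], where
    [hpoch 1 1 r] leaves only r = 0. *)
Lemma hpoch_vandermonde w c n :
  hpoch 1 w n =
  \sum_(j < n.+1) qbin n j
      * (hpoch 0 1 j * hpoch w c j * hpoch 1 (c * q ^+ j) (n - j)).
Proof.
rewrite hpoch_conv_shift big_ord_recl big1 => [|i _]; last first.
  by rewrite hpoch11 /= mulr0 mulr0.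
by rewrite qbin0 subn0 !hpoch0 /=; ring.
Qed.

End QBinomial.

(** * Two expansions of the inner series with a common value *)

Section Transformation.
Set Implicit Arguments.
Unset Strict Implicit.
Variables (F : fieldType) (q : F).
Notation hpoch := (hpoch q).
Notation qbin := (qbin q).
Hypothesis q_nroot : forall k, q ^+ k.+1 != 1.

Definition hcoef (p s x y : F) (j : nat) : F :=
  \sum_(l < j.+1) qbin j l
     * (hpoch 1 s l * (p * x) ^+ l * (hpoch 1 p (j - l) * (s * y) ^+ (j - l))).

Lemma hcoefZ t p s x y j : hcoef p s (t * x) (t * y) j = t ^+ j * hcoef p s x y j.
Proof.
rewrite mulr_sumr; apply: eq_bigr => -[l /= ltl] _.
have -> : t ^+ j = t ^+ l * t ^+ (j - l) by rewrite -exprD subnKC.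
by rewrite (mulrCA p t) (mulrCA s t) !(exprMn _ t); ring.
Qed.

(* A common value of the two expansions of D_k: it is a terminating 3phi2 with
   argument q and upper parameters q^-k, p, y. *)
Definition phisum (p s x y : F) (k : nat) : F :=
  \sum_(i < k.+1) qbin k i
    * (hpoch 1 s (k - i) * hpoch s (s * y) i * hpoch 1 p i
       * hpoch 1 (p * x * q ^+ i) (k - i)).

Lemma sum_hcoef p s x y k :
  \sum_(j < k.+1) qbin k j
     * (hpoch 0 1 j * hpoch 1 (p * s * q ^+ j) (k - j) * hcoef p s x y j)
  = phisum p s x y k.
Proof.
pose f l i := hpoch 0 1 (l + i) * hpoch 1 (p * s * q ^+ (l + i)) (k - (l + i))
  * (hpoch 1 s l * (p * x) ^+ l * (hpoch 1 p i * (s * y) ^+ i)).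
transitivity (\sum_(j < k.+1) qbin k j * (\sum_(l < j.+1) qbin j l * f l (j - l)%N)).
  apply: eq_bigr => j _; rewrite mulr_sumr; congr (_ * _); apply: eq_bigr => -[l /= ltl] _.
  by rewrite /f subnKC //; ring.
rewrite sum_qbin_triangle //.
transitivity (\sum_(l < k.+1) qbin k l * \sum_(r < (k - l).+1) qbin (k - l) r *
   (hpoch 0 (p * x * q ^+ r) l * (hpoch 1 s (k - r) * hpoch s (s * y) r * hpoch 1 p r))).
  apply: eq_bigr => -[l /= ltl] _; congr (_ * _).
  (* With s q^l as the intermediate point, [hpoch 1 s l] is completed to [hpoch 1 s (k - r)]. The
     index l then survives only in [hpoch 0 (p * x * q ^+ r) l], and the l-sum can be evaluated
     after the exchange. *)
  have E := hpoch_conv_shift q_nroot y 1 (s * q ^+ l) (s * q ^+ l * p) (k - l).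
  transitivity (hpoch 0 (p * x) l * hpoch 1 s l * \sum_(i < (k - l).+1)
     qbin (k - l) i * (hpoch 0 y i * hpoch (s * q ^+ l) (s * q ^+ l * p) i *
         hpoch 1 (s * q ^+ l * p * q ^+ i) (k - l - i))).
    rewrite mulr_sumr; apply: eq_bigr => -[i /= lti] _; rewrite /f subnDA hpochD mul1r.
    rewrite hpoch_homog exprD (hpoch0E q (p * x)) (hpoch0E q (q ^+ l)) (hpoch0E q y) !exprMn.
    have -> : p * s * (q ^+ l * q ^+ i) = s * q ^+ l * p * q ^+ i by ring.
    by ring.
  rewrite E mulr_sumr; apply: eq_bigr => -[r /= ltr] _.
  have -> : hpoch 1 s (k - r) = hpoch 1 s l * hpoch 1 (s * q ^+ l) (k - l - r).
    by rewrite -hpochD; congr hpoch; lia.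
  rewrite !hpoch_homog (hpoch0E q (p * x)) (hpoch0E q (p * x * _)) !exprMn.
  by rewrite -!exprM [(l * r)%N]mulnC; ring.
rewrite (sum_qbin_exchange q_nroot k (fun l r => hpoch 0 (p * x * q ^+ r) l *
  (hpoch 1 s (k - r) * hpoch s (s * y) r * hpoch 1 p r))).
apply: eq_bigr => -[r /= ltr] _; congr (_ * _).
rewrite (hpoch_conv q 1 0 (p * x * q ^+ r)) mulr_sumr; apply: eq_bigr => l _.
by rewrite hpochx0 expr1n; ring.
Qed.

Lemma sum_phi32 p s x y k :
  \sum_(j < k.+1) qbin k j
     * (hpoch 0 1 j * hpoch 1 x j * hpoch 1 y j * (p * s) ^+ j
        * (hpoch 1 (p * x * q ^+ j) (k - j) * hpoch 1 (s * y * q ^+ j) (k - j)))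
  = phisum p s x y k.
Proof.
pose f j i := hpoch 1 s (k - (j + i)) * hpoch s (s * y) (j + i)
  * (hpoch 0 1 j * hpoch p (p * x) j * hpoch 1 (p * x * q ^+ j) (k - j)).
symmetry.
transitivity (\sum_(r < k.+1) qbin k r * (\sum_(j < r.+1) qbin r j * f j (r - j)%N)).
  apply: eq_bigr => -[r /= ltr] _; congr (_ * _).
  (* Expanding (p; q)_r through p x produces (x; q)_j, since [hpoch p (p * x) j] is p^j (x; q)_j.
     The remaining sum over r - j is a convolution through s. *)
  rewrite (hpoch_vandermonde q_nroot p (p * x)) mulr_sumr mulr_suml.
  apply: eq_bigr => -[j /= ltj] _; rewrite /f subnKC //.
  have -> : (k - j = (r - j) + (k - r))%N by lia.
  by rewrite hpochD -(mulrA (p * x) (q ^+ j)) -exprD subnKC //; ring.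
rewrite sum_qbin_triangle //; apply: eq_bigr => -[j /= ltj] _; congr (_ * _).
rewrite (hpoch_conv q 1 s (s * y * q ^+ j)) 2!mulr_sumr.
apply: eq_bigr => -[i /= lti] _; rewrite /f hpochD subnDA.
by rewrite !hpoch_homog exprMn; ring.
Qed.

(** * The two-term relation for the 3phi2 with a zero upper parameter *)

Lemma sum_hpoch0 c M : q != 0 ->
  \sum_(s < M.+1) qbin M s
     * (hpoch 0 1 s * (q / q ^+ M) ^+ s * hpoch 1 (c * q ^+ s) (M - s))
  = hpoch 0 c M.
Proof.
move=> q0; elim: M c => [|M IHM] c; first by rewrite big_ord1 !hpoch0 expr0 !mulr1.
rewrite (sum_qbinS q M (fun s => hpoch 0 1 s * (q / q ^+ M.+1) ^+ s *
  hpoch 1 (c * q ^+ s) (M.+1 - s))).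
rewrite hpochSl sub0r -IHM mulr_sumr; apply: eq_bigr => -[s /= lts] _.
have -> : q / q ^+ M.+1 = (q ^+ M)^-1 by rewrite exprS; field; rewrite q0 expf_neq0.
rewrite subSS subSn // hpochSl hpochS -(mulrA c q) -exprS -(mulrA c (q ^+ s)) -exprSr.
have : q ^+ (M - s) * q ^+ s / q ^+ M = 1 by rewrite -exprD subnK // mulfV ?expf_neq0.
set z := (q ^+ M)^-1 => Hz; rewrite exprMn [z ^+ s.+1]exprSr.
set X := hpoch 1 (c * q ^+ s.+1) _.
(* The two Pascal terms share all factors but the bracket, which [Hz] reduces to - c q^s. *)
transitivity (qbin M s * hpoch 0 1 s * z ^+ s * X
                * (1 - c * q ^+ s - q ^+ (M - s) * q ^+ s * z)); first by ring.
by rewrite Hz; ring.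
Qed.

(** Reversal of a product: w - d q^k = - d q^k (1 - d' q^(M+i-1-k)). The other factors on the left
    cancel the signs and powers of q. The induction on i keeps M + i fixed. *)
Lemma hpoch_rev w d d' i M : q != 0 -> w * q = d * d' * q ^+ (M + i) ->
  hpoch w d i * (q / q ^+ (M + i)) ^+ i * hpoch 0 1 i * q ^+ (i * M)
  = d ^+ i * hpoch 1 (d' * q ^+ M) i.
Proof.
move=> q0; elim: i M => [|i IHi] M Hw; first by rewrite !hpoch0 !mulr1.
have Hw' : w * q = d * d' * q ^+ (M.+1 + i) by rewrite addSnnS.
have := IHi _ Hw'.
rewrite [hpoch 1 _ _.+1]hpochSl [hpoch w d i.+1]hpochS [hpoch 0 1 i.+1]hpochS -(mulrA d') -exprSr.
rewrite addSnnS => E.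
transitivity (d * (1 - d' * q ^+ M) * (hpoch w d i * (q / q ^+ (M + i.+1)) ^+ i *
  hpoch 0 1 i * q ^+ (i * M.+1))); last by rewrite E [d ^+ i.+1]exprS; ring.
have -> : w = d * d' * q ^+ M * q ^+ i.
  by apply: (mulIf q0); rewrite Hw addnS exprSr exprD; ring.
have -> : q / q ^+ (M + i.+1) = (q ^+ M * q ^+ i)^-1.
  by rewrite addnS exprS exprD; field; rewrite q0 !expf_neq0.
rewrite [_ ^+ i.+1]exprSr mulSn mulnS !exprD.
set z := _^-1 ^+ i; move: (hpoch w d i) (hpoch 0 1 i) z => H1 H2 z.
by field; rewrite !expf_neq0.
Qed.

Lemma hpoch_neq0 x n k : (k <= n)%N -> hpoch 1 x n != 0 -> hpoch 1 x k != 0.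
Proof. by move=> lekn; rewrite -(subnKC lekn) hpochD mulf_eq0 => /norP[]. Qed.

Lemma hpoch_split x n k : (k <= n)%N ->
  hpoch 1 x n = hpoch 1 x k * hpoch 1 (x * q ^+ k) (n - k).
Proof. by move=> lekn; rewrite -hpochD subnKC. Qed.

(* 3phi2(q^-N, A q^N, 0; d, e; q, q). *)
Definition phi32_0 N A d e : F :=
  \sum_(k < N.+1) qbin N k * (hpoch 0 1 k * (q / q ^+ N) ^+ k
     * hpoch 1 (A * q ^+ N) k / (hpoch 1 d k * hpoch 1 e k)).

(** Expanding (A q^N; q)_r by Vandermonde through d cancels part of (d; q)_r. The inner sum then
    involves only e and is [sum_hpoch0], and [hpoch_rev] replaces A by d'. *)
Lemma phi32_0_sum N A d d' e : q != 0 -> A * q = d * d' ->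
  hpoch 1 d N != 0 -> hpoch 1 d' N != 0 -> hpoch 1 e N != 0 ->
  phi32_0 N A d e = hpoch 1 d' N / hpoch 1 e N * hpoch 0 1 N
    * \sum_(i < N.+1) qbin N i * (e ^+ (N - i) * d ^+ i / q ^+ (i * (N - i))
        / (hpoch 1 d i * hpoch 1 d' (N - i))).
Proof.
move=> q0 HA d0 d'0 e0; set w := A * q ^+ N; set z := q / q ^+ N.
pose f i s := hpoch 0 1 (i + s) * z ^+ (i + s) * hpoch 0 1 i * hpoch w d i
  / hpoch 1 d i / hpoch 1 e (i + s).
transitivity (\sum_(r < N.+1) qbin N r * (\sum_(j < r.+1) qbin r j * f j (r - j)%N)).
  apply: eq_bigr => -[r /= ltr] _; congr (_ * _); rewrite -/w -/z.
  rewrite (hpoch_vandermonde q_nroot w d) mulr_sumr mulr_suml.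
  apply: eq_bigr => -[j /= ltj] _; rewrite /f subnKC // (@hpoch_split d r j) //.
  have dr : hpoch 1 d r != 0 by apply: hpoch_neq0 d0.
  have er : hpoch 1 e r != 0 by apply: hpoch_neq0 e0.
  move: dr; rewrite (@hpoch_split d r j) // mulf_eq0 => /norP[? ?].
  by field; apply/and3P.
rewrite sum_qbin_triangle // mulr_sumr; apply: eq_bigr => -[i /= lti] _.
rewrite [RHS]mulrCA; congr (_ * _).
have lei : (i <= N)%N by [].
transitivity (hpoch 0 1 i * z ^+ i * hpoch 0 1 i * hpoch w d i / hpoch 1 d i / hpoch 1 e N
  * hpoch 0 (e * q ^+ i) (N - i)).
  rewrite -(sum_hpoch0 (e * q ^+ i) (N - i) q0) mulr_sumr; apply: eq_bigr => -[s /= lts] _.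
  have les : (i + s <= N)%N by lia.
  rewrite /f hpochD mul1r (hpoch0E _ (q ^+ i)) (@hpoch_split e N (i + s)) //.
  rewrite -(mulrA e) -exprD subnDA.
  have -> : q / q ^+ (N - i) = z * q ^+ i.
    rewrite /z; have -> : q ^+ N = q ^+ (N - i) * q ^+ i by rewrite -exprD subnK.
    by field; rewrite !expf_neq0.
  rewrite [(z * _) ^+ s]exprMn [z ^+ (i + s)]exprD.
  have := e0; rewrite (@hpoch_split e N (i + s)) // subnDA mulf_eq0 => /norP[? ?].
  have di := hpoch_neq0 lei d0.
  by field; apply/and3P.
have := @hpoch_rev w d d' i (N - i) q0; rewrite subnK // => /(_ _) Hrev.
have {}Hrev : hpoch w d i * z ^+ i * hpoch 0 1 i = d ^+ i * hpoch 1 (d' * q ^+ (N - i)) i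
   / q ^+ (i * (N - i)).
  rewrite -Hrev ?mulfK ?expf_neq0 //.
  by rewrite /w mulrAC HA.
transitivity (hpoch 0 1 i * (hpoch w d i * z ^+ i * hpoch 0 1 i) / hpoch 1 d i
  / hpoch 1 e N * hpoch 0 (e * q ^+ i) (N - i)); first by ring.
have -> : hpoch 0 1 N = hpoch 0 1 i * (q ^+ (i * (N - i)) * hpoch 0 1 (N - i)).
  by rewrite -{1}(subnKC lei) hpochD mul1r (hpoch0E _ (q ^+ i)) exprM.
have E : hpoch 1 d' N = hpoch 1 d' (N - i) * hpoch 1 (d' * q ^+ (N - i)) i.
  by rewrite -hpochD subnK.
rewrite Hrev (hpoch0E _ (e * _)) exprMn -exprM E.
move: d'0; rewrite E mulf_eq0 => /norP[? _].
by field; rewrite e0 (hpoch_neq0 lei d0) expf_neq0 //; apply/andP.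
Qed.

(** Apply [phi32_0_sum] on the left with d' = d and on the right with d' = t e: the two single sums
    agree under i -> N - i. *)
Lemma phi32_0_transf N A d e t : q != 0 -> A * q = t * (d * e) ->
  hpoch 1 d N != 0 -> hpoch 1 e N != 0 ->
  hpoch 1 (t * d) N != 0 -> hpoch 1 (t * e) N != 0 ->
  phi32_0 N A (t * e) (t * d) =
  hpoch 1 d N * hpoch 1 e N / (hpoch 1 (t * d) N * hpoch 1 (t * e) N) * t ^+ N
    * phi32_0 N A d e.
Proof.
move=> q0 HA d0 e0 td0 te0.
rewrite (@phi32_0_sum _ _ _ d) //; last by rewrite HA; ring.
rewrite (@phi32_0_sum _ _ _ (t * e)) //; last by rewrite HA; ring.
rewrite !mulr_sumr [RHS](reindex_inj rev_ord_inj); apply: eq_bigr => -[i /= lti] _.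
rewrite subSS (qbinC q_nroot) // subKn // [((N - i) * i)%N]mulnC !exprMn.
have -> : t ^+ N = t ^+ i * t ^+ (N - i) by rewrite -exprD subnKC.
have di := @hpoch_neq0 _ _ (N - i) (leq_subr _ _) d0.
have tei := @hpoch_neq0 _ _ i (lti : (i <= N)%N) te0.
by field; rewrite td0 te0 e0 di tei expf_neq0.
Qed.

(** * From the series to q-binomial sums, and comparison of coefficients *)

Lemma qpoch_negX k j : q != 0 -> (j <= k)%N ->
  qpoch q (q ^- k) j = qpoch q q j * qbin k j * hpoch 0 1 j / (q ^+ k) ^+ j.
Proof.
move=> q0; elim: j => [|j IHj] ltjk.
  by rewrite !qpochE !hpoch0 qbin0 expr0 invr1 !mulr1.
have E : qbin k j.+1 * (1 - q ^+ j.+1) = qbin k j * (1 - q ^+ (k - j)).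
  have kj : (k - j = (k - j.+1).+1)%N by lia.
  rewrite !(qbinE q_nroot) ?(ltnW ltjk) // kj !qpochE !hpochS -!exprS -kj.
  have := qfact_neq0 q_nroot (k - j); have := qfact_neq0 q_nroot j.+1.
  rewrite kj !qpochE !hpochS -!exprS -kj !mulf_eq0 => /norP[? ?] /norP[? ?].
  by field; apply/and4P.
rewrite qpochE hpochS -qpochE (IHj (ltnW ltjk)).
rewrite [qpoch q q j.+1]qpochE hpochS -qpochE -exprS.
transitivity (qpoch q q j * (qbin k j.+1 * (1 - q ^+ j.+1)) * hpoch 0 1 j.+1
   / (q ^+ k) ^+ j.+1); last by ring.
rewrite E hpochS.
have -> : q ^+ k = q ^+ (k - j) * q ^+ j by rewrite -exprD subnK // ltnW.
rewrite exprS.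
set z := _ ^+ j; have z0 : z != 0 by rewrite expf_neq0 // mulf_neq0 ?expf_neq0.
by field; rewrite z0 !expf_neq0.
Qed.

(** The expansion of D_k in the E_j: after multiplication by (p s; q)_k both sides equal [phisum],
    by [sum_phi32] and [sum_hcoef]. *)
Lemma phi32_expansion p s x y k : q != 0 ->
  hpoch 1 (p * x) k != 0 -> hpoch 1 (s * y) k != 0 -> hpoch 1 (p * s) k != 0 ->
  qpoch q (p * x) k * qpoch q (s * y) k / qpoch q (p * s) k
    * tphi32 q k x y (p * x) (s * y) (p * s * q ^+ k)
  = \sum_(j < k.+1) qbin k j * (hpoch 0 1 j * hcoef p s x y j / hpoch 1 (p * s) j).
Proof.
move=> q0 px0 sy0 ps0; apply: (mulIf ps0).
have := sum_hcoef p s x y k; rewrite -sum_phi32 => E.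
rewrite !qpochE; transitivity (hpoch 1 (p * x) k * hpoch 1 (s * y) k
    * tphi32 q k x y (p * x) (s * y) (p * s * q ^+ k)); first by field.
transitivity (\sum_(j < k.+1) qbin k j
     * (hpoch 0 1 j * hpoch 1 x j * hpoch 1 y j * (p * s) ^+ j
        * (hpoch 1 (p * x * q ^+ j) (k - j) * hpoch 1 (s * y * q ^+ j) (k - j)))).
  rewrite mulr_sumr; apply: eq_bigr => -[j /= ltj] _.
  have lej : (j <= k)%N by [].
  rewrite qpoch_negX // !qpochE (hpoch_split (p * x) lej) (hpoch_split (s * y) lej).
  have ? := hpoch_neq0 lej px0; have ? := hpoch_neq0 lej sy0.
  have ? : hpoch 1 q j != 0 := qfact_neq0 q_nroot j.
  rewrite exprMn; field.
  by do !(apply/andP; split) => //; rewrite !expf_neq0.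
rewrite -E mulr_suml; apply: eq_bigr => -[j /= ltj] _.
have lej : (j <= k)%N by [].
have ? := hpoch_neq0 lej ps0.
by rewrite (hpoch_split (p * s) lej); field.
Qed.

(** Insert [phi32_expansion], set k = j + i and split each factorial at j. The tail is again a
    [phi32_0], with A q^(2j) because A q^(2j) q^(n-j) = A q^n q^j. *)
Lemma outer_sum n A d e p s x y : q != 0 ->
  hpoch 1 d n != 0 -> hpoch 1 e n != 0 ->
  hpoch 1 (p * x) n != 0 -> hpoch 1 (s * y) n != 0 -> hpoch 1 (p * s) n != 0 ->
  \sum_(k < n.+1)
     (qpoch q (q ^- n) k * qpoch q (A * q ^+ n) k
        * qpoch q (p * x) k * qpoch q (s * y) k * q ^+ k)
     / (qpoch q q k * qpoch q d k * qpoch q e k * qpoch q (p * s) k)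
     * tphi32 q k x y (p * x) (s * y) (p * s * q ^+ k)
  = \sum_(j < n.+1) qbin n j
     * (hpoch 0 1 j * (q / q ^+ n) ^+ j * hpoch 1 (A * q ^+ n) j
          / (hpoch 1 d j * hpoch 1 e j)
        * (hpoch 0 1 j * hcoef p s x y j / hpoch 1 (p * s) j)
        * phi32_0 (n - j) (A * q ^+ (j + j)) (d * q ^+ j) (e * q ^+ j)).
Proof.
move=> q0 d0 e0 px0 sy0 ps0.
pose g k := hpoch 0 1 k * (q / q ^+ n) ^+ k * hpoch 1 (A * q ^+ n) k
              / (hpoch 1 d k * hpoch 1 e k).
pose c j := hpoch 0 1 j * hcoef p s x y j / hpoch 1 (p * s) j.
pose f j i := g (j + i)%N * c j.
transitivity (\sum_(k < n.+1) qbin n k * (\sum_(j < k.+1) qbin k j * f j (k - j)%N)).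
  apply: eq_bigr => -[k /= ltk] _; have lek : (k <= n)%N by [].
  transitivity (qbin n k * g k * (qpoch q (p * x) k * qpoch q (s * y) k
    / qpoch q (p * s) k * tphi32 q k x y (p * x) (s * y) (p * s * q ^+ k))).
    rewrite qpoch_negX // /g exprMn exprVn.
    have ? : qpoch q q k != 0 := qfact_neq0 q_nroot k.
    have ? := hpoch_neq0 lek d0; have ? := hpoch_neq0 lek e0.
    have ? := hpoch_neq0 lek ps0.
    by rewrite -!qpochE in d0 e0 *; field; do !(apply/andP; split) => //; rewrite !expf_neq0.
  rewrite phi32_expansion ?(hpoch_neq0 lek) // -mulrA; congr (_ * _).
  rewrite mulr_sumr; apply: eq_bigr => -[j /= ltj] _.
  by rewrite /f subnKC // /c; ring.
rewrite sum_qbin_triangle //; apply: eq_bigr => -[j /= ltj] _; congr (_ * _).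
have lej : (j <= n)%N by [].
rewrite mulr_sumr; apply: eq_bigr => -[i /= lti] _; rewrite /f /g -/(c j).
have leji : (j + i <= n)%N by lia.
have := hpoch_neq0 leji d0; have := hpoch_neq0 leji e0.
rewrite !hpochD !mulf_eq0 => /norP[? ?] /norP[? ?].
have -> : A * q ^+ (j + j) * q ^+ (n - j) = A * q ^+ n * q ^+ j.
  by rewrite -!mulrA -!exprD; congr (_ * _ ^+ _); lia.
have -> : q / q ^+ (n - j) = q / q ^+ n * q ^+ j.
  have -> : q ^+ n = q ^+ (n - j) * q ^+ j by rewrite -exprD subnK.
  by field; rewrite !expf_neq0.
set z := q / q ^+ n.
rewrite mul1r (hpoch0E _ (q ^+ j)) [z ^+ (j + i)]exprD [(z * _) ^+ i]exprMn.
by field; do !(apply/andP; split).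
Qed.

Lemma phi32_sum_transf n A d e t p s x y : q != 0 -> A * q = t * (d * e) ->
  hpoch 1 d n != 0 -> hpoch 1 e n != 0 ->
  hpoch 1 (t * d) n != 0 -> hpoch 1 (t * e) n != 0 ->
  hpoch 1 (p * x) n != 0 -> hpoch 1 (s * y) n != 0 ->
  hpoch 1 (p * (t * x)) n != 0 -> hpoch 1 (s * (t * y)) n != 0 ->
  hpoch 1 (p * s) n != 0 ->
  \sum_(k < n.+1)
     (qpoch q (q ^- n) k * qpoch q (A * q ^+ n) k
        * qpoch q (p * (t * x)) k * qpoch q (s * (t * y)) k * q ^+ k)
     / (qpoch q q k * qpoch q (t * e) k * qpoch q (t * d) k * qpoch q (p * s) k)
     * tphi32 q k (t * x) (t * y) (p * (t * x)) (s * (t * y)) (p * s * q ^+ k)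
  = (qpoch q d n * qpoch q e n) / (qpoch q (t * e) n * qpoch q (t * d) n) * t ^+ n
  * \sum_(k < n.+1)
     (qpoch q (q ^- n) k * qpoch q (A * q ^+ n) k
        * qpoch q (p * x) k * qpoch q (s * y) k * q ^+ k)
     / (qpoch q q k * qpoch q d k * qpoch q e k * qpoch q (p * s) k)
     * tphi32 q k x y (p * x) (s * y) (p * s * q ^+ k).
Proof.
move=> q0 HA d0 e0 td0 te0 px0 sy0 ptx0 sty0 ps0.
rewrite !outer_sum // mulr_sumr; apply: eq_bigr => -[j /= ltj] _.
have lej : (j <= n)%N by [].
have Hs z : hpoch 1 z n = hpoch 1 z j * hpoch 1 (z * q ^+ j) (n - j).
  exact: hpoch_split.
have := d0; have := e0; have := td0; have := te0.
rewrite !Hs !mulf_eq0 -!(mulrA t) => /norP[? ?] /norP[? ?] /norP[? ?] /norP[? ?].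
(* The condition on A persists after the shift: A q^(2j) q = t (d q^j)(e q^j). This relation gives
   t^(n-j) and [hcoefZ] gives t^j, hence t^n for every j. *)
rewrite phi32_0_transf //; last by rewrite exprD mulrAC HA; ring.
rewrite hcoefZ !qpochE !Hs -!(mulrA t).
have -> : t ^+ n = t ^+ j * t ^+ (n - j) by rewrite -exprD subnKC.
have ? := hpoch_neq0 lej ps0.
by field; do !(apply/andP; split).
Qed.
End Transformation.

(** * Specialisation of the parameters *)

Theorem theorem3p7 (R : rcfType) (q : R[i]) (n : nat)
  (alpha a b beta gamma u v : R[i]) :
  0 < `|q| -> `|q| < 1 ->
  a != 0 -> b != 0 -> u != 0 -> v != 0 ->
  qpoch q (alpha * a) n != 0 ->
  qpoch q (alpha * b) n != 0 ->
  qpoch q (beta * gamma * u * v) n != 0 ->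
  qpoch q (q / a) n != 0 ->
  qpoch q (q / b) n != 0 ->
  qpoch q (alpha * beta * a * b / q) n != 0 ->
  qpoch q (alpha * gamma * a * b / q) n != 0 ->
  qpoch q beta n != 0 ->
  qpoch q gamma n != 0 ->
  \sum_(k < n.+1)
     (qpoch q (q ^- n) k * qpoch q (alpha * q ^+ n) k
        * qpoch q (alpha * beta * a * b / q) k
        * qpoch q (alpha * gamma * a * b / q) k * q ^+ k)
     / (qpoch q q k * qpoch q (alpha * a) k * qpoch q (alpha * b) k
        * qpoch q (beta * gamma * u * v) k)
     * tphi32 q k (alpha * a * b / (q * u)) (alpha * a * b / (q * v))
         (alpha * beta * a * b / q) (alpha * gamma * a * b / q)
         (beta * gamma * u * v * q ^+ k)
  =
  (qpoch q (q / a) n * qpoch q (q / b) n)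
    / (qpoch q (alpha * a) n * qpoch q (alpha * b) n)
    * (alpha * a * b / q) ^+ n
    * \sum_(k < n.+1)
        (qpoch q (q ^- n) k * qpoch q (alpha * q ^+ n) k
           * qpoch q beta k * qpoch q gamma k * q ^+ k)
        / (qpoch q q k * qpoch q (q / a) k * qpoch q (q / b) k
           * qpoch q (beta * gamma * u * v) k)
        * tphi32 q k (u^-1) (v^-1) beta gamma (beta * gamma * u * v * q ^+ k).
Proof.
move=> q_gt0 q_lt1 a0 b0 u0 v0.
have q0 : q != 0 by rewrite -normr_gt0.
have q_nroot k : q ^+ k.+1 != 1.
  apply/eqP => /(congr1 Num.norm); rewrite normrX normr1 => /eqP.
  by rewrite lt_eqF // exprn_ilt1.
set t := alpha * a * b / q.
(* Dictionary: p = beta u, s = gamma v, x = 1/u, y = 1/v, d = q/a, e = q/b, A = alpha. Thus alpha a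
   = t e and alpha b = t d. *)
have -> : alpha * beta * a * b / q = beta * u * (t * u^-1).
  by rewrite /t; field; rewrite q0 u0.
have -> : alpha * gamma * a * b / q = gamma * v * (t * v^-1).
  by rewrite /t; field; rewrite q0 v0.
have -> : alpha * a * b / (q * u) = t * u^-1 by rewrite /t; field; rewrite q0 u0.
have -> : alpha * a * b / (q * v) = t * v^-1 by rewrite /t; field; rewrite q0 v0.
have -> : beta * gamma * u * v = beta * u * (gamma * v) by ring.
have -> : alpha * a = t * (q / b) by rewrite /t; field; rewrite q0 b0.
have -> : alpha * b = t * (q / a) by rewrite /t; field; rewrite q0 a0.
move=> tb0 ta0 bg0 qa0 qb0 tbeta0 tgamma0 beta0 gamma0.
have := @phi32_sum_transf _ q q_nroot n alpha (q / a) (q / b) t (beta * u)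
  (gamma * v) u^-1 v^-1 q0.
rewrite !mulfK //; apply => //.
by rewrite /t; field; rewrite q0 a0 b0.
Qed.
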